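(* Let $K\subseteq\mathbb{R}^n$ be nonempty, closed and convex, let $H,Q:\mathbb{R}^n\to\mathbb{R}^n$ be continuous, and let $\eta>0$. Let $R_\eta(x)=H(x)-P_K(H(x)-\eta Q(x))$ and assume that $X^*=\{x\in\mathbb{R}^n:R_\eta(x)=0\}$ is nonempty and closed. Suppose that: (1) there is $L_R>0$ such that $\|R_\eta(x)-R_\eta(y)\|\le L_R\|x-y\|$ for all $x,y\in\mathbb{R}^n$; (2) $R_\eta$ is monotone, i.e. $\langle R_\eta(x)-R_\eta(y),x-y\rangle\ge 0$ for all $x,y\in\mathbb{R}^n$. Let $\alpha\in(0,1/L_R)$, let $x_0\in\mathbb{R}^n$ be arbitrary, and for $k=0,1,2,\dots$ let $$\widehat x_k=x_k-\alpha R_\eta(x_k),\qquad x_{k+1}=x_k-\alpha R_\eta(\widehat x_k).$$ Then, for every $k\ge 0$, $$\operatorname{dist}(x_{k+1},X^* )^2\le \operatorname{dist}(x_k,X^* )^2-\alpha^2(1-\alpha^2L_R^2)\|R_\eta(x_k)\|^2 .$$ Consequently, for every $T\ge 1$, $$\min_{0\le k\le T-1}\operatorname{Gap}_\eta(x_k)^2\le \frac{\operatorname{dist}(x_0,X^* )^2}{\eta^2\alpha^2(1-\alpha^2L_R^2)T}.$$ Thus $\min_{0\le k\le T-1}\operatorname{Gap}_\eta(x_k)=\mathcal{O}(T^{-1/2})$ as $T\to\infty$. Moreover, $\|R_\eta(x_k)\|\to 0$ as $k\to\infty$.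
   Context: $\langle\cdot,\cdot\rangle$ and $\|\cdot\|$ are the Euclidean inner product and norm on $\mathbb{R}^n$. $P_K$ is the Euclidean projection onto $K$, and $\operatorname{dist}(x,X^* )=\min_{y\in X^*}\|x-y\|$. The normalized residual measure is $\operatorname{Gap}_\eta(x)=\eta^{-1}\|R_\eta(x)\|$. (The zeros of $R_\eta$ are the solutions of the general variational inequality: find $x^*$ with $H(x^* )\in K$ and $\langle y-H(x^* ),Q(x^* )\rangle\ge 0$ for all $y\in K$.) *)

(* Defs.v *)
From mathcomp Require Import all_boot all_order all_algebra.
From mathcomp Require Import all_classical all_reals all_analysis.

Set Implicit Arguments.
Unset Strict Implicit.
Unset Printing Implicit Defensive.

Import Order.TTheory GRing.Theory Num.Theory.
Import numFieldNormedType.Exports.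

Local Open Scope classical_set_scope.
Local Open Scope ring_scope.

(* R^n is 'rV[R]_n.  Its library norm `|x| is the sup norm, so the Euclidean
   structure is defined separately; both norms induce the library topology, which
   is the one used for closedness and continuity. *)
Definition inner (R : realType) (n : nat) (u v : 'rV[R]_n) : R :=
  \sum_(i < n) u 0 i * v 0 i.

Definition enorm (R : realType) (n : nat) (u : 'rV[R]_n) : R :=
  Num.sqrt (inner u u).

(* Minimum of a set of reals; a default value when the minimum is not attained. *)
Definition setmin (R : realType) (S : set R) : R :=
  get [set m | S m /\ lbound S m].

(* Minimum of u 0, ..., u T.-1 when T >= 1. *)
Definition minseq (R : realType) (u : nat -> R) (T : nat) : R :=
  \big[Num.min/u 0%N]_(k < T) u k.

(* The nearest point of K to x: it exists and is unique when K is nonempty,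
   closed and convex, and is a default value when there is no nearest point. *)
Definition eproj (R : realType) (n : nat) (K : set 'rV[R]_n)
    (x : 'rV[R]_n) : 'rV[R]_n :=
  get [set p | K p /\ forall y, K y -> enorm (x - p) <= enorm (x - y)].

Definition edistmin (R : realType) (n : nat) (x : 'rV[R]_n)
    (A : set 'rV[R]_n) : R :=
  setmin [set enorm (x - y) | y in A].

Definition residual (R : realType) (n : nat) (K : set 'rV[R]_n)
    (H Q : 'rV[R]_n -> 'rV[R]_n) (eta : R) (x : 'rV[R]_n) : 'rV[R]_n :=
  H x - eproj K (H x - eta *: Q x).

Definition Gap (R : realType) (n : nat) (K : set 'rV[R]_n)
    (H Q : 'rV[R]_n -> 'rV[R]_n) (eta : R) (x : 'rV[R]_n) : R :=
  eta^-1 * enorm (residual K H Q eta x).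

Definition zeroset (R : realType) (n : nat) (F : 'rV[R]_n -> 'rV[R]_n) :
    set 'rV[R]_n :=
  [set x | F x = 0].

(* Main.v *)
Require Import Defs.
From mathcomp Require Import all_boot all_order all_algebra.
From mathcomp Require Import all_classical all_reals all_analysis.
From mathcomp Require Import ring lra.

Set Implicit Arguments.
Unset Strict Implicit.
Unset Printing Implicit Defensive.

Import Order.TTheory GRing.Theory Num.Theory.
Import numFieldNormedType.Exports.

Local Open Scope classical_set_scope.
Local Open Scope ring_scope.


(** The sequence is the extragradient method for a monotone Lipschitz map [F],
    here the residual, and everything follows from one energy inequality. Let
    [p] be a zero of [F], write [u = F x], [v = F xh] with [xh = x - alpha u],
    and let [x+ = x - alpha v]. Expanding the square,
      |x+ - p|^2 = |x - p|^2 - 2 alpha <v, x - p> + alpha^2 |v|^2.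
    Since [x - p = (xh - p) + alpha u] and monotonicity at [xh] and [p] gives
    [<v, xh - p> >= 0], the right side is at most
      |x - p|^2 + alpha^2 (|v - u|^2 - |u|^2),
    and [|v - u| <= L alpha |u|] by the Lipschitz bound. This is
    [extragradient_step].

    Taking for [p] a point of the solution set nearest to [x] turns it into the
    decrease of the squared distance; such a point exists because a closed set
    meets a large box around [x] in a compact set ([nearest_point_exists]).

    The rest concerns real sequences with [D (k+1) <= D k - c a k]. Telescoping
    gives [c T m <= D 0] for every lower bound [m] of the first [T] terms of [a]
    ([decrease_lower_bound]); with [m] the minimum of the squared gaps this is
    the rate, and with [m] the square of the minimal gap it gives the
    asymptotic bound. As [D] is nonincreasing and nonnegative it converges, so
    its increments, and hence [a], tend to [0] ([decrease_cvg0]). *)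

(** * Euclidean distance to a closed set *)

Section Euclidean.
Variables (R : realType) (n : nat).
Implicit Types u v w x y : 'rV[R]_n.

Lemma innerC u v : inner u v = inner v u.
Proof. by apply: eq_bigr => i _; rewrite mulrC. Qed.

Lemma innerBr u v w : inner u (v - w) = inner u v - inner u w.
Proof. by rewrite -sumrB; apply: eq_bigr => i _; rewrite !mxE mulrBr. Qed.

Lemma innerZr (a : R) u v : inner u (a *: v) = a * inner u v.
Proof. by rewrite mulr_sumr; apply: eq_bigr => i _; rewrite !mxE mulrCA. Qed.

Lemma innerBl u v w : inner (v - w) u = inner v u - inner w u.
Proof. by rewrite innerC innerBr !(innerC u). Qed.

Lemma innerZl (a : R) u v : inner (a *: v) u = a * inner v u.
Proof. by rewrite innerC innerZr innerC. Qed.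

Lemma enorm_ge0 u : 0 <= enorm u.
Proof. exact: sqrtr_ge0. Qed.

Lemma enorm_sqr u : enorm u ^+ 2 = inner u u.
Proof. by rewrite sqr_sqrtr// sumr_ge0// => i _; rewrite -expr2 sqr_ge0. Qed.

(** Links the Euclidean norm to the coordinatewise description of boxes, for
    which compactness is available. *)
Lemma ler_coord_enorm u i : `|u 0 i| <= enorm u.
Proof.
rewrite -sqrtr_sqr ler_wsqrtr// /inner (bigD1 i)//= -expr2 lerDl.
by rewrite sumr_ge0// => j _; rewrite -expr2 sqr_ge0.
Qed.

Lemma continuous_enormB x : continuous (fun y => enorm (x - y)).
Proof.
move=> z; apply: (continuous_comp (f := fun y => inner (x - y) (x - y)));
  last exact: sqrt_continuous.
move: z; rewrite /inner; apply: (continuous_big (op := +%R)) => [|i _ {}y].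
  exact: add_continuous.
have cB : {for y, continuous (fun z : 'rV[R]_n => (x - z) 0 i)}.
  rewrite (_ : (fun _ => _) = (fun z : 'rV[R]_n => x 0 i - z 0 i)); last first.
    by apply/funext => z; rewrite !mxE.
  by apply: continuousB; [exact: cst_continuous|exact: coord_continuous].
exact: continuousM.
Qed.

(** With [y0] any point of [A] and [r] its distance to [x], the box of
    half-width [r] around [x] cuts [A] in a compact set, on which the distance
    to [x] has a minimizer. It is a minimizer on all of [A], since points
    outside the box are farther from [x] than [y0]. *)
Lemma nearest_point_exists (A : set 'rV[R]_n) x :
  closed A -> A !=set0 ->
  exists2 p, A p & forall q, A q -> enorm (x - p) <= enorm (x - q).
Proof.
move=> Acl [y0 Ay0]; set r := enorm (x - y0).
pose box := [set v : 'rV[R]_n | forall i, `[x 0 i - r, x 0 i + r]%classic (v ord0 i)].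
have boxP q : enorm (x - q) <= r -> box q.
  move=> xqr i; have := le_trans (ler_coord_enorm (x - q) i) xqr.
  by rewrite !mxE ler_norml /= in_itv /= => /andP[? ?]; apply/andP; split; lra.
have boxA_compact : compact (box `&` A).
  apply: compact_closedI => //.
  apply: (@rV_compact _ _ (fun i => `[x 0 i - r, x 0 i + r]%classic)) => i.
  exact: segment_compact.
have boxA_neq0 : (box `&` A) !=set0 by exists y0; split => //; exact: boxP.
have [p] := EVT_min_rV boxA_neq0 boxA_compact
  (continuous_subspaceT (continuous_enormB (x := x))).
rewrite inE => -[_ Ap] pmin; exists p => // q Aq.
have [xqr|rxq] := leP (enorm (x - q)) r.
  by apply: pmin; rewrite inE; split => //; exact: boxP.
apply: le_trans (ltW rxq); apply: pmin; rewrite inE; split => //.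
exact: boxP.
Qed.

Lemma edistmin_attained (A : set 'rV[R]_n) x :
  closed A -> A !=set0 ->
  exists2 p, A p & edistmin x A = enorm (x - p) /\
                   forall q, A q -> edistmin x A <= enorm (x - q).
Proof.
move=> Acl A0; have [p Ap pmin] := nearest_point_exists x Acl A0.
suff distE : edistmin x A = enorm (x - p) by exists p; rewrite ?distE.
apply: get_unique => /=.
  by split; [exists p|move=> _ [q Aq <-]; exact: pmin].
move=> _ [[q Aq <-] qmin]; apply/eqP; rewrite eq_le pmin// andbT.
by apply: qmin; exists p.
Qed.

Lemma edistmin_le (A : set 'rV[R]_n) x q :
  closed A -> A q -> edistmin x A <= enorm (x - q).
Proof.
move=> Acl Aq; have A0 : A !=set0 by exists q.
by have [p _ [_]] := edistmin_attained x Acl A0; exact.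
Qed.

Lemma edistmin_ge0 (A : set 'rV[R]_n) x :
  closed A -> A !=set0 -> 0 <= edistmin x A.
Proof. by move=> Acl /(edistmin_attained x Acl)[p _ [-> _]]; exact: enorm_ge0. Qed.

End Euclidean.

(** * The extragradient step *)

Section Extragradient.
Variables (R : realType) (n : nat) (F : 'rV[R]_n -> 'rV[R]_n) (L alpha : R).
Hypothesis L_ge0 : 0 <= L.
Hypothesis F_lipschitz : forall y z, enorm (F y - F z) <= L * enorm (y - z).
Hypothesis F_monotone : forall y z, 0 <= inner (F y - F z) (y - z).
Hypothesis alpha_ge0 : 0 <= alpha.

(** The one inequality behind the method: monotonicity is used between the
    predictor and the zero [p], the Lipschitz bound between the predictor and
    [x]. *)
Lemma extragradient_step x p : F p = 0 ->
  enorm (x - alpha *: F (x - alpha *: F x) - p) ^+ 2 <=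
  enorm (x - p) ^+ 2
  - alpha ^+ 2 * (1 - alpha ^+ 2 * L ^+ 2) * enorm (F x) ^+ 2.
Proof.
move=> Fp; set xh := x - _ *: F x.
have lip : enorm (F xh - F x) ^+ 2 <= L ^+ 2 * (alpha ^+ 2 * enorm (F x) ^+ 2).
  have -> : alpha ^+ 2 * enorm (F x) ^+ 2 = enorm (xh - x) ^+ 2.
    rewrite !enorm_sqr (_ : xh - x = (- alpha) *: F x).
      by rewrite innerZl innerZr; ring.
    by rewrite /xh addrC addKr scaleNr.
  rewrite -exprMn ler_pXn2r ?nnegrE ?enorm_ge0//.
  by rewrite mulr_ge0 ?enorm_ge0.
have mono : 0 <= inner (F xh) (x - p) - alpha * inner (F xh) (F x).
  rewrite -innerZr -innerBr addrAC -/xh.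
  by have := F_monotone xh p; rewrite Fp subr0.
(* From here on only the two inequalities matter, so the vectors are
   generalized: d = x - p, u = F x and v = F xh. *)
rewrite addrAC; move: lip mono; move: (F xh) (F x) (x - p) => v u d lip mono.
have -> : enorm (d - alpha *: v) ^+ 2 = enorm d ^+ 2
    - 2 * alpha * (inner v d - alpha * inner v u)
    + alpha ^+ 2 * (enorm (v - u) ^+ 2 - enorm u ^+ 2).
  rewrite !enorm_sqr !(innerBl, innerBr, innerZl, innerZr).
  by rewrite (innerC d v) (innerC u v); ring.
have := mulr_ge0 alpha_ge0 mono.
have : 0 <= alpha ^+ 2 * (L ^+ 2 * (alpha ^+ 2 * enorm u ^+ 2) - enorm (v - u) ^+ 2).
  by rewrite mulr_ge0 ?sqr_ge0// subr_ge0.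
move: (inner v d - _) => s; move: (enorm (v - u) ^+ 2) (enorm u ^+ 2) => a b.
lra.
Qed.

(** The energy inequality at the zero [p] nearest to [x]: on the right
    the distance to [p] is the distance to the zero set, while on the left it
    bounds that distance from above, which is the direction needed. *)
Lemma edistmin_extragradient_step x : closed (zeroset F) -> zeroset F !=set0 ->
  edistmin (x - alpha *: F (x - alpha *: F x)) (zeroset F) ^+ 2 <=
  edistmin x (zeroset F) ^+ 2
  - alpha ^+ 2 * (1 - alpha ^+ 2 * L ^+ 2) * enorm (F x) ^+ 2.
Proof.
move=> Xcl X0; have [p Xp [-> _]] := edistmin_attained x Xcl X0.
apply: le_trans (extragradient_step x Xp).
by rewrite ler_pXn2r ?nnegrE ?enorm_ge0 ?edistmin_ge0// edistmin_le.
Qed.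

End Extragradient.

(** * Sequences with a summable decrease *)

Section Decrease.
Variables (R : realType) (D a : nat -> R) (c : R).
Hypothesis c_gt0 : 0 < c.
Hypothesis D_ge0 : forall k, 0 <= D k.
Hypothesis a_ge0 : forall k, 0 <= a k.
Hypothesis D_step : forall k, D k.+1 <= D k - c * a k.

(** Telescoping. A lower bound [m] is used rather than the minimum of [a] so
    that it also applies to the square of a minimum of square roots. *)
Lemma decrease_lower_bound m T :
  (forall k, (k < T)%N -> m <= a k) -> c * T%:R * m <= D 0.
Proof.
(* The induction needs the remaining energy D T, dropped at the end. *)
move=> ma; suff : c * T%:R * m + D T <= D 0.
  by apply: le_trans; rewrite lerDl.
elim: T ma => [|T IH] ma; first by rewrite mulr0 mul0r add0r.
have := IH (fun k kT => ma k (ltnW kT)).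
have := D_step T; have := ler_wpM2l (ltW c_gt0) (ma T (ltnSn T)).
rewrite -natr1; lra.
Qed.

(** [a k] is squeezed between [0] and the scaled increments of [D], which
    vanish because [D] converges. *)
Lemma decrease_cvg0 : a @ \oo --> 0.
Proof.
have Dcvg : cvgn D.
  apply: nonincreasing_is_cvgn.
    apply/nonincreasing_seqP => k.
    by apply: le_trans (D_step k) _; rewrite gerBl mulr_ge0// ltW.
  by exists 0 => _ [k _ <-].
have diff0 : (fun k => c^-1 * (D k - D k.+1)) @ \oo --> 0.
  rewrite -(mulr0 c^-1) -(subrr (limn D)).
  apply: cvgM; first exact: cvg_cst.
  by apply: cvgB => //; rewrite (cvg_shiftS D).
apply: (squeeze_cvgr _ (cvg_cst 0) diff0).
near=> k; rewrite a_ge0/= ler_pdivlMl//.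
by have := D_step k; lra.
Unshelve. all: by end_near. Qed.

End Decrease.

(** * Minimum of an initial segment *)

Lemma minseq_le (R : realType) (u : nat -> R) T k :
  (k < T)%N -> minseq u T <= u k.
Proof. by move=> kT; exact: (bigmin_le _ (Ordinal kT) (fun i : 'I_T => u i)). Qed.

Lemma minseq_ge0 (R : realType) (u : nat -> R) T :
  (forall k, 0 <= u k) -> 0 <= minseq u T.
Proof. by move=> u0; apply: le_bigmin. Qed.

(** * Convergence of the method *)

Theorem theorem4p3 (R : realType) (n : nat) (K : set 'rV[R]_n)
    (H Q : 'rV[R]_n -> 'rV[R]_n) (eta L_R alpha : R)
    (x xhat : nat -> 'rV[R]_n)
    (K_neq0 : K !=set0) (K_closed : closed K)
    (K_convex : convex_set (M := 'rV[R]_n) K)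
    (H_cont : continuous H) (Q_cont : continuous Q)
    (eta_gt0 : 0 < eta)
    (Xstar_neq0 : zeroset (residual K H Q eta) !=set0)
    (Xstar_closed : closed (zeroset (residual K H Q eta)))
    (L_R_gt0 : 0 < L_R)
    (residual_lipschitz : forall y z : 'rV[R]_n,
      enorm (residual K H Q eta y - residual K H Q eta z)
        <= L_R * enorm (y - z))
    (residual_monotone : forall y z : 'rV[R]_n,
      0 <= inner (residual K H Q eta y - residual K H Q eta z) (y - z))
    (alpha_gt0 : 0 < alpha) (alpha_lt : alpha < 1 / L_R)
    (xhat_def : forall k : nat,
      xhat k = x k - alpha *: residual K H Q eta (x k))
    (x_rec : forall k : nat,
      x k.+1 = x k - alpha *: residual K H Q eta (xhat k)) :
  let Xstar := zeroset (residual K H Q eta) in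
  (forall k : nat,
    edistmin (x k.+1) Xstar ^+ 2 <=
      edistmin (x k) Xstar ^+ 2
      - alpha ^+ 2 * (1 - alpha ^+ 2 * L_R ^+ 2)
        * enorm (residual K H Q eta (x k)) ^+ 2) /\
  (forall T : nat, (1 <= T)%N ->
    minseq (fun k => Gap K H Q eta (x k) ^+ 2) T <=
      edistmin (x 0%N) Xstar ^+ 2
      / (eta ^+ 2 * alpha ^+ 2 * (1 - alpha ^+ 2 * L_R ^+ 2) * T%:R)) /\
  ((fun T : nat => minseq (fun k => Gap K H Q eta (x k)) T : R^o)
     =O_\oo (fun T : nat => T%:R `^ (- 2^-1) : R^o)) /\
  (fun k : nat => enorm (residual K H Q eta (x k))) @ \oo --> (0 : R).
Proof.
move=> Xstar.
set F := residual K H Q eta in residual_lipschitz residual_monotone xhat_def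
  x_rec Xstar Xstar_neq0 Xstar_closed *.
pose c := alpha ^+ 2 * (1 - alpha ^+ 2 * L_R ^+ 2).
have c_gt0 : 0 < c.
  rewrite mulr_gt0 ?exprn_gt0// subr_gt0 -exprMn expr_lt1//.
    by rewrite -ltr_pdivlMr.
  by rewrite mulr_ge0 ?ltW.
pose D k := edistmin (x k) Xstar ^+ 2.
have D_ge0 k : 0 <= D k by exact: sqr_ge0.
have D_step k : D k.+1 <= D k - c * enorm (F (x k)) ^+ 2.
  rewrite /D x_rec xhat_def.
  by apply: edistmin_extragradient_step => //; exact: ltW.
(* Gap^2 = |F|^2 / eta^2, so the same decrease holds for the squared gaps with
   the constant multiplied by eta^2. *)
have Gap_step k : D k.+1 <= D k - eta ^+ 2 * c * Gap K H Q eta (x k) ^+ 2.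
  rewrite /Gap exprMn exprVn.
  rewrite (_ : _ * (_ * _) = c * enorm (F (x k)) ^+ 2)//.
  by rewrite -/F; field; exact: lt0r_neq0.
have ec_gt0 : 0 < eta ^+ 2 * c by rewrite mulr_gt0 ?exprn_gt0.
have Gap_ge0 k : 0 <= Gap K H Q eta (x k).
  by rewrite mulr_ge0 ?invr_ge0 ?enorm_ge0 ?ltW.
split; first exact: D_step.
split.
  move=> T T_gt0.
  have ecT_gt0 : 0 < eta ^+ 2 * c * T%:R by apply: mulr_gt0; rewrite ?ltr0n.
  rewrite -(mulrA (eta ^+ 2)) -/c ler_pdivlMr// [leLHS]mulrC.
  by apply: (decrease_lower_bound ec_gt0 D_ge0 Gap_step) => k; exact: minseq_le.
split.
  (* The square g^2 of the minimal gap is a lower bound of the squared gaps, so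
     g <= sqrt (D 0 / (eta^2 c)) / sqrt T; the added 1 only makes the constant
     positive when D 0 = 0. *)
  apply/eqO_exP; exists (Num.sqrt (D 0%N / (eta ^+ 2 * c)) + 1).
    by rewrite ltr_wpDl ?sqrtr_ge0.
  near=> T.
  have T_gt0 : (0 < T)%N by near: T; exists 1%N.
  have g_ge0 := minseq_ge0 T Gap_ge0.
  rewrite ger0_norm// ger0_norm ?powR_ge0// powRN powR12_sqrt//.
  rewrite -sqrtrV// mulrDl mul1r ler_wpDr ?sqrtr_ge0//.
  have C_ge0 : 0 <= D 0%N / (eta ^+ 2 * c) by apply: divr_ge0 => //; exact: ltW.
  rewrite -sqrtrM// -[leLHS](ger0_norm g_ge0) -sqrtr_sqr.
  apply: ler_wsqrtr.
  rewrite ler_pdivlMr ?ltr0n// ler_pdivlMr// -mulrA mulrC [T%:R * _]mulrC.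
  apply: (decrease_lower_bound ec_gt0 D_ge0 Gap_step) => k kT.
  by rewrite ler_pXn2r ?nnegrE// minseq_le.
have sq0 := decrease_cvg0 c_gt0 D_ge0 (fun k => sqr_ge0 (enorm (F (x k)))) D_step.
rewrite -(sqrtr0 R).
have -> : (fun k => enorm (F (x k))) = (fun k => Num.sqrt (enorm (F (x k)) ^+ 2)).
  by apply/funext => k; rewrite sqrtr_sqr ger0_norm ?enorm_ge0.
(* The squares tend to 0 and the square root is continuous at 0. *)
by apply: continuous_cvg sq0; exact: sqrt_continuous.
Unshelve. all: by end_near. Qed.
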